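(* $B_4(\mathbb{S}^2)\cong \mathcal{Q}_{16}\ast_{\mathcal{Q}_8}T^{*}$, that is, the $4$-string braid group of the $2$-sphere is isomorphic to the amalgamated product of the generalised quaternion group of order $16$ and the binary tetrahedral group along a common normal subgroup isomorphic to the quaternion group $\mathcal{Q}_8$ of order $8$.
   Context: $B_4(\mathbb{S}^2)$ is the $4$-string braid group of the $2$-sphere; it has a presentation with generators $\sigma_1,\sigma_2,\sigma_3$ and relations $\sigma_1\sigma_3=\sigma_3\sigma_1$, $\sigma_1\sigma_2\sigma_1=\sigma_2\sigma_1\sigma_2$, $\sigma_2\sigma_3\sigma_2=\sigma_3\sigma_2\sigma_3$, $\sigma_1\sigma_2\sigma_3^2\sigma_2\sigma_1=1$. $\mathcal{Q}_{16}=\langle u,v\mid u^4=v^2,\ vuv^{-1}=u^{-1}\rangle$; $T^{*}=\langle p,q,r\mid p^2=q^2,\ qpq^{-1}=p^{-1},\ rpr^{-1}=q,\ rqr^{-1}=pq,\ r^3=1\rangle$ is the binary tetrahedral group, of order $24$. The amalgamation identifies the index $2$ subgroup $\langle u^2,v\rangle\cong\mathcal{Q}_8$ of $\mathcal{Q}_{16}$ with the normal subgroup $\langle p,q\rangle\cong\mathcal{Q}_8$ of $T^{*}$ via $u^2=p$, $v=q$. *)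

(* Defs.v *)
(* Mathematical Components; groups are its (possibly infinite) [groupType]s. *)
From HB Require Import structures.
From mathcomp Require Import all_boot boolp.

Set Implicit Arguments.
Unset Strict Implicit.
Unset Printing Implicit Defensive.

Local Open Scope quotient_scope.
Local Open Scope group_scope.

(** * Free groups *)

(* The letter [(x, false)] stands for the generator [x], and [(x, true)] for
   its inverse. *)
Definition word (T : Type) := seq (T * bool).

Inductive free_eq (T : Type) : word T -> word T -> Prop :=
| FreeRefl w : free_eq w w
| FreeSym w1 w2 : free_eq w1 w2 -> free_eq w2 w1
| FreeTrans w1 w2 w3 : free_eq w1 w2 -> free_eq w2 w3 -> free_eq w1 w3
| FreeCancel w1 w2 x b : free_eq (w1 ++ [:: (x, b); (x, ~~ b)] ++ w2) (w1 ++ w2).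

Definition inv_word (T : Type) (w : word T) : word T :=
  rev [seq (a.1, ~~ a.2) | a <- w].

Section FreeGroup.
Variable T : choiceType.
Implicit Types w : word T.

Lemma free_eq_catl w w1 w2 : free_eq w1 w2 -> free_eq (w ++ w1) (w ++ w2).
Proof.
elim=> [u|u v _ IH|u v t _ IH1 _ IH2|u v x b]; first exact: FreeRefl.
- exact: FreeSym.
- exact: FreeTrans IH1 IH2.
- by rewrite !(catA w u); exact: FreeCancel.
Qed.

Lemma free_eq_catr w w1 w2 : free_eq w1 w2 -> free_eq (w1 ++ w) (w2 ++ w).
Proof.
elim=> [u|u v _ IH|u v t _ IH1 _ IH2|u v x b]; first exact: FreeRefl.
- exact: FreeSym.
- exact: FreeTrans IH1 IH2.
- by rewrite -!catA; exact: FreeCancel.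
Qed.

Lemma free_eq_cat w1 w2 w3 w4 :
  free_eq w1 w2 -> free_eq w3 w4 -> free_eq (w1 ++ w3) (w2 ++ w4).
Proof. by move=> h k; exact: FreeTrans (free_eq_catr _ h) (free_eq_catl _ k). Qed.

Lemma free_eq_inv w1 w2 : free_eq w1 w2 -> free_eq (inv_word w1) (inv_word w2).
Proof.
elim=> [u|u v _ IH|u v t _ IH1 _ IH2|u v x b]; first exact: FreeRefl.
- exact: FreeSym.
- exact: FreeTrans IH1 IH2.
- rewrite /inv_word !map_cat !rev_cat /= negbK -catA.
  exact: (FreeCancel _ _ x b).
Qed.

Lemma free_eq_invl w : free_eq (inv_word w ++ w) [::].
Proof.
elim: w => [|[x b] w IH]; first exact: FreeRefl.
rewrite /inv_word map_cons rev_cons -cats1 -catA /=.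
apply: FreeTrans IH; have := FreeCancel (inv_word w) w x (~~ b).
by rewrite negbK.
Qed.

Lemma inv_wordK : involutive (@inv_word T).
Proof.
move=> w; rewrite /inv_word map_rev revK -map_comp -[RHS]map_id.
by apply: eq_map => -[x b] /=; rewrite negbK.
Qed.

Lemma free_eq_invr w : free_eq (w ++ inv_word w) [::].
Proof. by rewrite -{1}[w]inv_wordK; exact: free_eq_invl. Qed.

Definition free_eqb : rel (word T) := fun w1 w2 => `[< free_eq w1 w2 >].

Lemma free_eqb_refl : reflexive free_eqb.
Proof. by move=> w; apply/asboolP; exact: FreeRefl. Qed.

Lemma free_eqb_sym : symmetric free_eqb.
Proof. by move=> w1 w2; apply/asboolP/asboolP; exact: FreeSym. Qed.

Lemma free_eqb_trans : transitive free_eqb.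
Proof.
by move=> w2 w1 w3 /asboolP h /asboolP k; apply/asboolP; exact: FreeTrans h k.
Qed.

Canonical free_equiv :=
  EquivRel free_eqb free_eqb_refl free_eqb_sym free_eqb_trans.

Definition free_group := {eq_quot free_equiv}.
HB.instance Definition _ := Choice.on free_group.
HB.instance Definition _ := EqQuotient.on free_group.

Implicit Types a b c : free_group.

Lemma free_piP w1 w2 :
  \pi_free_group w1 = \pi_free_group w2 <-> free_eq w1 w2.
Proof.
split=> [h|h]; last by apply/eqmodP/asboolP.
by apply/asboolP; move/eqmodP: h.
Qed.

Definition free_one : free_group := \pi_free_group [::].
Definition free_mul a b : free_group := \pi_free_group (repr a ++ repr b).
Definition free_inv a : free_group := \pi_free_group (inv_word (repr a)).
Definition free_gen (x : T) : free_group := \pi_free_group [:: (x, false)].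

Lemma free_reprP w : free_eq (repr (\pi_free_group w)) w.
Proof. by apply/free_piP; rewrite reprK. Qed.

Lemma free_mul_pi w1 w2 :
  free_mul (\pi_free_group w1) (\pi_free_group w2) = \pi_free_group (w1 ++ w2).
Proof. by apply/free_piP; apply: free_eq_cat; exact: free_reprP. Qed.

Lemma free_inv_pi w : free_inv (\pi_free_group w) = \pi_free_group (inv_word w).
Proof. by apply/free_piP; apply: free_eq_inv; exact: free_reprP. Qed.

Lemma free_mulA : associative free_mul.
Proof.
move=> a b c; rewrite -[a]reprK -[b]reprK -[c]reprK.
rewrite (free_mul_pi (repr b) (repr c)) (free_mul_pi (repr a) (repr b)).
by rewrite (free_mul_pi _ (_ ++ _)) (free_mul_pi (_ ++ _)) catA.
Qed.

Lemma free_mul1 : left_id free_one free_mul.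
Proof. by move=> a; rewrite -[a]reprK free_mul_pi. Qed.

Lemma free_mulr1 : right_id free_one free_mul.
Proof. by move=> a; rewrite -[a]reprK free_mul_pi cats0. Qed.

Lemma free_mulV : left_inverse free_one free_inv free_mul.
Proof.
move=> a; rewrite -[a]reprK free_inv_pi free_mul_pi.
by apply/free_piP; exact: free_eq_invl.
Qed.

Lemma free_mulrV : right_inverse free_one free_inv free_mul.
Proof.
move=> a; rewrite -[a]reprK free_inv_pi free_mul_pi.
by apply/free_piP; exact: free_eq_invr.
Qed.

HB.instance Definition _ := isGroup.Build free_group
  free_mulA free_mul1 free_mulr1 free_mulV free_mulrV.

End FreeGroup.

(** * Quotient by a normal closure *)

Inductive normal_closure (G : groupType) (A : G -> Prop) : G -> Prop :=
| NclIn a : A a -> normal_closure A a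
| Ncl1 : normal_closure A 1
| NclM a b : normal_closure A a -> normal_closure A b -> normal_closure A (a * b)
| NclV a : normal_closure A a -> normal_closure A a^-1
| NclJ a b : normal_closure A a -> normal_closure A (b * a * b^-1).

Section NormalQuotient.
Variables (G : groupType) (A : G -> Prop).
Implicit Types a b c : G.

Definition ncl_eqb : rel G := fun a b => `[< normal_closure A (a * b^-1) >].

Lemma ncl_eqb_refl : reflexive ncl_eqb.
Proof. by move=> a; apply/asboolP; rewrite mulgV; exact: Ncl1. Qed.

Lemma ncl_eqb_sym : symmetric ncl_eqb.
Proof.
by move=> a b; apply/asboolP/asboolP => /NclV; rewrite invgM invgK.
Qed.

Lemma ncl_eqb_trans : transitive ncl_eqb.
Proof.
move=> b a c /asboolP h /asboolP k; apply/asboolP; have := NclM h k.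
by rewrite mulgA mulgVK.
Qed.

Canonical ncl_equiv := EquivRel ncl_eqb ncl_eqb_refl ncl_eqb_sym ncl_eqb_trans.

Definition normal_quotient := {eq_quot ncl_equiv}.
HB.instance Definition _ := Choice.on normal_quotient.
HB.instance Definition _ := EqQuotient.on normal_quotient.

Implicit Types x y z : normal_quotient.

Lemma ncl_piP a b :
  \pi_normal_quotient a = \pi_normal_quotient b <-> normal_closure A (a * b^-1).
Proof.
split=> [h|h]; last by apply/eqmodP/asboolP.
by apply/asboolP; move/eqmodP: h.
Qed.

Definition nquo_one : normal_quotient := \pi_normal_quotient 1.
Definition nquo_mul x y : normal_quotient := \pi_normal_quotient (repr x * repr y).
Definition nquo_inv x : normal_quotient := \pi_normal_quotient ((repr x)^-1).

Lemma nquo_reprP a : normal_closure A (repr (\pi_normal_quotient a) * a^-1).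
Proof. by apply/ncl_piP; rewrite reprK. Qed.

Lemma nquo_mul_pi a b :
  nquo_mul (\pi_normal_quotient a) (\pi_normal_quotient b) =
  \pi_normal_quotient (a * b).
Proof.
apply/ncl_piP; have := NclM
  (NclJ (repr (\pi_normal_quotient a)) (nquo_reprP b)) (nquo_reprP a).
by rewrite invgM !mulgA mulgVK.
Qed.

Lemma nquo_inv_pi a : nquo_inv (\pi_normal_quotient a) = \pi_normal_quotient (a^-1).
Proof.
apply/ncl_piP; have := NclJ (repr (\pi_normal_quotient a))^-1
  (NclV (nquo_reprP a)).
by rewrite invgM !invgK !mulgA mulgVK.
Qed.

Lemma nquo_mulA : associative nquo_mul.
Proof.
move=> x y z; rewrite -[x]reprK -[y]reprK -[z]reprK.
rewrite (nquo_mul_pi (repr y) (repr z)) (nquo_mul_pi (repr x) (repr y)).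
by rewrite (nquo_mul_pi _ (_ * _)) (nquo_mul_pi (_ * _)) mulgA.
Qed.

Lemma nquo_mul1 : left_id nquo_one nquo_mul.
Proof. by move=> x; rewrite -[x]reprK nquo_mul_pi mul1g. Qed.

Lemma nquo_mulr1 : right_id nquo_one nquo_mul.
Proof. by move=> x; rewrite -[x]reprK nquo_mul_pi mulg1. Qed.

Lemma nquo_mulV : left_inverse nquo_one nquo_inv nquo_mul.
Proof. by move=> x; rewrite -[x]reprK nquo_inv_pi nquo_mul_pi mulVg. Qed.

Lemma nquo_mulrV : right_inverse nquo_one nquo_inv nquo_mul.
Proof. by move=> x; rewrite -[x]reprK nquo_inv_pi nquo_mul_pi mulgV. Qed.

HB.instance Definition _ := isGroup.Build normal_quotient
  nquo_mulA nquo_mul1 nquo_mulr1 nquo_mulV nquo_mulrV.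

End NormalQuotient.

(** * Presentations *)

(* [presented R] is the group generated by [T], subject to the relations
   [l = r] for all [l], [r] with [R l r]. *)
Definition presented (T : choiceType)
    (R : free_group T -> free_group T -> Prop) : groupType :=
  normal_quotient (fun a => exists l r, R l r /\ a = l * r^-1).

Definition pgen (T : choiceType) (R : free_group T -> free_group T -> Prop)
    (x : T) : presented R :=
  \pi_(normal_quotient _) (free_gen x).

(* The generators of a finite presentation are numbered from 0. *)
Definition rels_of (n : nat) (s : seq (free_group 'I_n * free_group 'I_n)) :
    free_group 'I_n -> free_group 'I_n -> Prop :=
  fun l r => (l, r) \in s.

(** * Amalgamated products *)

Section Amalgam.
Variables (H G1 G2 : groupType).
Variables (i : {multiplicative H -> G1}) (j : {multiplicative H -> G2}).

Let g1 (a : G1) : free_group (G1 + G2)%type := free_gen (inl a).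
Let g2 (b : G2) : free_group (G1 + G2)%type := free_gen (inr b).

(* The first two families of relations define the free product of [G1] and
   [G2]. *)
Inductive amalgam_rel :
    free_group (G1 + G2)%type -> free_group (G1 + G2)%type -> Prop :=
| AmalgamL a b : amalgam_rel (g1 a * g1 b) (g1 (a * b))
| AmalgamR a b : amalgam_rel (g2 a * g2 b) (g2 (a * b))
| AmalgamGlue h : amalgam_rel (g1 (i h)) (g2 (j h)).

Definition amalgam : groupType := presented amalgam_rel.

End Amalgam.

(** * The groups at hand *)

(* A multiplicative map between groups is a group homomorphism. *)
Definition isomorphic (G H : groupType) : Prop :=
  exists f : {multiplicative G -> H}, bijective f.

Definition has_order (G : groupType) (n : nat) : Prop :=
  exists f : 'I_n -> G, bijective f.

Definition normal_image (H G : groupType) (f : H -> G) : Prop :=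
  forall (g : G) (h : H), exists h' : H, g * f h * g^-1 = f h'.

Section SphereBraidGroup.

Definition s1 : 'I_3 := Ordinal (isT : 0 < 3).
Definition s2 : 'I_3 := Ordinal (isT : 1 < 3).
Definition s3 : 'I_3 := Ordinal (isT : 2 < 3).

Let a := free_gen s1.
Let b := free_gen s2.
Let c := free_gen s3.

(* The 4-string braid group of the 2-sphere, by its standard (Fadell - Van
   Buskirk) presentation. *)
Definition B4S2_rel := rels_of
  [:: (a * c, c * a);
      (a * b * a, b * a * b);
      (b * c * b, c * b * c);
      (a * b * c ^+ 2 * b * a, 1)].

Definition B4S2 : groupType := presented B4S2_rel.

End SphereBraidGroup.

Section QuaternionGroup.
Variable m : nat.

Definition gu : 'I_2 := Ordinal (isT : 0 < 2).
Definition gv : 'I_2 := Ordinal (isT : 1 < 2).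

Let u := free_gen gu.
Let v := free_gen gv.

(* The generalised quaternion group of order [4 * m]. *)
Definition quaternion_rel := rels_of
  [:: (u ^+ m, v ^+ 2); (v * u * v^-1, u^-1)].

Definition quaternion : groupType := presented quaternion_rel.

Definition qu : quaternion := pgen quaternion_rel gu.
Definition qv : quaternion := pgen quaternion_rel gv.

End QuaternionGroup.

Section BinaryTetrahedralGroup.

Definition gp : 'I_3 := Ordinal (isT : 0 < 3).
Definition gq : 'I_3 := Ordinal (isT : 1 < 3).
Definition gr : 'I_3 := Ordinal (isT : 2 < 3).

Let p := free_gen gp.
Let q := free_gen gq.
Let r := free_gen gr.

Definition Tstar_rel := rels_of
  [:: (p ^+ 2, q ^+ 2);
      (q * p * q^-1, p^-1);
      (r * p * r^-1, q);
      (r * q * r^-1, p * q);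
      (r ^+ 3, 1)].

Definition Tstar : groupType := presented Tstar_rel.

Definition tp : Tstar := pgen Tstar_rel gp.
Definition tq : Tstar := pgen Tstar_rel gq.

End BinaryTetrahedralGroup.

Definition Q8 : groupType := quaternion 2.
Definition Q16 : groupType := quaternion 4.

(* Main.v *)
(* In B_4(S^2) put u = s1 s2 s3, v = u s1 s2 s1 (the half twist) and
   r = (u s3 u^2)^-1. The sphere relation says that s3 s2 s1 = u^-1, whence
   v u v^-1 = u^-1 and u^4 = v^2. Conjugation by s3 maps u^2 to v and v to
   u^-2, which yields the relations of T^* for p = u^2, q = v and r.
   Conversely, s1 = (r u^3)^-1, s2 = (u r u^2)^-1 and s3 = (u^2 r u)^-1, and
   these elements of the amalgamated product satisfy the braid relations:
   u s1 = s2 u and u s2 = s3 u hold by construction, and s1 s2 s3 = u amounts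
   to r^3 = 1, u^4 being central of order 2.
   The orders of the finite groups and the injectivity of the maps from Q_8 are
   read off normal forms u^k v^e and p^k q^e r^c, whose distinctness is
   witnessed by permutation actions. *)
Require Import Defs.
From HB Require Import structures.
From mathcomp Require Import all_boot perm ssralg zmodp.

Set Implicit Arguments.
Unset Strict Implicit.
Unset Printing Implicit Defensive.

Local Open Scope quotient_scope.
Local Open Scope group_scope.

(** * Universal property of presentations *)

(* Only the magma structure of [{multiplicative G -> H}] is used, so that the
   library's [gmulf1] and [gmulfV], which require a [UMagmaMorphism], do not
   apply. *)
Section MultiplicativeMaps.
Variables (G H : groupType) (f : {multiplicative G -> H}).

Lemma multiplicative1 : f 1 = 1.
Proof. by apply: (mulgI (f 1)); rewrite -gmulfM !mulg1. Qed.

Lemma multiplicativeV : {morph f : x / x^-1}.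
Proof.
by move=> x; apply/esym/mulg1_eq; rewrite -gmulfM mulgV multiplicative1.
Qed.

Lemma multiplicativeX n : {morph f : x / x ^+ n}.
Proof.
by move=> x; elim: n => [|n IH]; rewrite ?multiplicative1 // !expgS gmulfM IH.
Qed.

End MultiplicativeMaps.

(** * Homomorphisms out of a free group *)

Section FreeLift.
Variables (T : choiceType) (G : groupType) (f : T -> G).

Definition eval_word (w : word T) : G :=
  \prod_(a <- w) (if a.2 then (f a.1)^-1 else f a.1).

Lemma eval_word_free_eq w1 w2 : free_eq w1 w2 -> eval_word w1 = eval_word w2.
Proof.
elim=> // [u v t _ -> _ -> //|u v x b].
rewrite /eval_word !big_cat /= unlock /= mulg1.
by case: b => /=; rewrite ?mulgV ?mulVg mul1g.
Qed.

Definition free_lift (a : free_group T) : G := eval_word (repr a).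

Lemma free_lift_pi w : free_lift (\pi_(free_group T) w) = eval_word w.
Proof. exact/eval_word_free_eq/free_reprP. Qed.

Lemma free_lift_gen x : free_lift (free_gen x) = f x.
Proof. by rewrite free_lift_pi /eval_word big_seq1. Qed.

Lemma free_liftM : {morph free_lift : a b / a * b}.
Proof. by move=> a b; rewrite [LHS]free_lift_pi /eval_word big_cat. Qed.

HB.instance Definition _ := isMultiplicative.Build _ _ free_lift free_liftM.

End FreeLift.

Lemma free_ind (T : choiceType) (P : free_group T -> Prop) :
  P 1 -> (forall a b, P a -> P b -> P (a * b)) -> (forall a, P a -> P a^-1) ->
  (forall x, P (free_gen x)) -> forall a, P a.
Proof.
move=> P1 PM PV Pg a; rewrite -[a]reprK; elim: (repr a) => [//|[x b] w IH].
have -> : \pi_(free_group T) ((x, b) :: w) =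
          (if b then (free_gen x)^-1 else free_gen x) * \pi_(free_group T) w.
  by case: b; rewrite /mul /= /inv /= ?free_inv_pi free_mul_pi.
by apply: PM => //; case: b => //; apply: PV.
Qed.

(** * Homomorphisms out of a presented group *)

Section Presented.
Variables (T : choiceType) (R : free_group T -> free_group T -> Prop).

Let pr (a : free_group T) : presented R := \pi_(normal_quotient _) a.

Let prM : {morph pr : a b / a * b}.
Proof. by move=> a b; rewrite [RHS]nquo_mul_pi. Qed.

HB.instance Definition _ := isMultiplicative.Build _ _ pr prM.

(** Written as an evaluation at the generators, the projection is computed on relators by the
    morphism lemmas. *)
Lemma presented_free_lift (a : free_group T) :
  free_lift (pgen R) a = \pi_(normal_quotient _) a.
Proof.
apply: (free_ind (P := fun a => free_lift (pgen R) a = pr a)) => {a}.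
- by rewrite !multiplicative1.
- by move=> a b ea eb; rewrite !gmulfM /= ea eb.
- by move=> a ea; rewrite !multiplicativeV /= ea.
- by move=> x; rewrite free_lift_gen.
Qed.

Lemma presented_rel l r :
  R l r -> free_lift (pgen R) l = free_lift (pgen R) r.
Proof.
move=> Rlr; rewrite !presented_free_lift; apply/ncl_piP.
by apply: NclIn; exists l, r.
Qed.

Lemma presented_ind (P : presented R -> Prop) :
  P 1 -> (forall a b, P a -> P b -> P (a * b)) -> (forall a, P a -> P a^-1) ->
  (forall x, P (pgen R x)) -> forall a, P a.
Proof.
move=> P1 PM PV Pg a; rewrite -[a]reprK.
apply: (free_ind (P := fun a => P (pr a))) => //.
- by move=> b c; rewrite gmulfM; apply: PM.
- by move=> b; rewrite multiplicativeV; apply: PV.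
Qed.

Lemma presented_ext (G : groupType) (f g : {multiplicative presented R -> G}) :
  (forall x, f (pgen R x) = g (pgen R x)) -> f =1 g.
Proof.
move=> efg; apply: presented_ind => //.
- by rewrite !multiplicative1.
- by move=> a b ea eb; rewrite !gmulfM /= ea eb.
- by move=> a ea; rewrite !multiplicativeV /= ea.
Qed.

(** Von Dyck's theorem: evaluation kills the normal closure of the relators, so its value on a
    representative depends only on the class. *)
Lemma presented_lift (G : groupType) (f : T -> G) :
    (forall l r, R l r -> free_lift f l = free_lift f r) ->
  exists F : {multiplicative presented R -> G}, forall x, F (pgen R x) = f x.
Proof.
move=> fR; pose F (a : presented R) : G := free_lift f (repr a).
have FE a : F (pr a) = free_lift f a.
  have: normal_closure (fun c => exists l r, R l r /\ c = l * r^-1)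
    (repr (pr a) * a^-1) by exact: nquo_reprP.
  suff ncl1 c : normal_closure (fun c => exists l r, R l r /\ c = l * r^-1) c ->
      free_lift f c = 1.
    by move/ncl1; rewrite gmulfM multiplicativeV => /divg1_eq.
  elim=> [_ [l [r [Rlr ->]]]||b d _ eb _ ed|b _ eb|b d _ eb].
  - by rewrite gmulfM multiplicativeV /= (fR _ _ Rlr) mulgV.
  - by rewrite multiplicative1.
  - by rewrite gmulfM /= eb ed mulg1.
  - by rewrite multiplicativeV /= eb invg1.
  - by rewrite !gmulfM multiplicativeV /= eb mulg1 mulgV.
have FM : {morph F : a b / a * b}.
  move=> a b; rewrite -[a]reprK -[b]reprK -/(pr _) -/(pr _).
  by rewrite -gmulfM !FE gmulfM.
pose Fm := isMultiplicative.Build _ _ F FM.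
pose F' : {multiplicative presented R -> G} := HB.pack F Fm.
by exists F' => x; rewrite /F' /= [LHS]FE free_lift_gen.
Qed.

(* If right multiplication by the generators permutes the candidate normal forms
   as in an action of the presented group, and this action carries the base
   point to every normal form, then the action is simply transitive. *)
Lemma normal_form_bij (X : finType) (x0 : X) (act : T -> {perm X})
    (nf : X -> presented R) :
    (forall l r, R l r -> free_lift act l = free_lift act r) ->
    nf x0 = 1 -> (forall x t, nf x * pgen R t = nf (act t x)) ->
    (forall F : {multiplicative presented R -> {perm X}},
       (forall t, F (pgen R t) = act t) -> forall x, F (nf x) x0 = x) ->
  bijective nf.
Proof.
move=> actR nf0 nfM nfK; have [F Fg] := presented_lift actR.
(* Equivariance passes from the generators to the whole group; at [x0] it reads
   [a = nf (F a x0)]. *)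
have nfF a : forall x, nf x * a = nf (F a x).
  elim/presented_ind: a => [x|a b IHa IHb x|a IH x|t x].
  - by rewrite multiplicative1 perm1 mulg1.
  - by rewrite gmulfM permM mulgA IHa IHb.
  - by apply: (mulIg a); rewrite mulgVK IH multiplicativeV permKV.
  - by rewrite Fg nfM.
exists (fun a => F a x0) => [x|a]; first exact: nfK.
by rewrite -nfF nf0 mul1g.
Qed.

End Presented.

Lemma normal_image_gen (S T : choiceType)
    (Q : free_group S -> free_group S -> Prop)
    (R : free_group T -> free_group T -> Prop)
    (f : {multiplicative presented Q -> presented R}) :
    (forall t s, exists h,
      pgen R t * f (pgen Q s) * (pgen R t)^-1 = f h) ->
    (forall t s, exists h,
      (pgen R t)^-1 * f (pgen Q s) * pgen R t = f h) ->
  normal_image f.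
Proof.
move=> fJ fJV; pose N g := forall h, exists h', g * f h * g^-1 = f h'.
have Ngen g : (forall s, exists h, g * f (pgen Q s) * g^-1 = f h) -> N g.
  move=> Ng; apply: presented_ind => [|a b [a' ea] [b' eb]|a [a' ea]|//].
  - by exists 1; rewrite !multiplicative1 mulg1 mulgV.
  - by exists (a' * b'); rewrite !gmulfM -ea -eb !mulgA mulgVK.
  - by exists a'^-1; rewrite !multiplicativeV -ea !invgM invgK mulgA.
(* Treating [g] and [g^-1] together lets the induction pass through inverses. *)
suff NN g : N g /\ N g^-1 by move=> g; case: (NN g).
elim/presented_ind: g => [|a b [Na NaV] [Nb NbV]|a []|t].
- by rewrite invg1; split=> h; exists h; rewrite invg1 mulg1 mul1g.
- split=> h; last rewrite invgM.
    have [h1 e1] := Nb h; have [h2 e2] := Na h1.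
    by exists h2; rewrite -e2 -e1 invgM !mulgA.
  have [h1 e1] := NaV h; have [h2 e2] := NbV h1.
  by exists h2; rewrite -e2 -e1 invgM !mulgA.
- by rewrite invgK.
- by split; apply: Ngen => s //; have [h] := fJV t s; exists h; rewrite invgK.
Qed.

Lemma has_order_card (X : finType) (G : groupType) (f : X -> G) :
  bijective f -> has_order G #|X|.
Proof.
by move=> bf; exists (f \o @enum_val X X); exact: bij_comp bf (@enum_val_bij X).
Qed.


(** * Generalised quaternion groups *)

Lemma I2_cases (P : 'I_2 -> Prop) : P gu -> P gv -> forall t, P t.
Proof.
move=> Pu Pv; case=> -[|[|//]] lt.
  by rewrite (_ : Ordinal lt = gu) //; apply: val_inj.
by rewrite (_ : Ordinal lt = gv) //; apply: val_inj.
Qed.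

Lemma I3_cases (P : 'I_3 -> Prop) : P gp -> P gq -> P gr -> forall t, P t.
Proof.
move=> Pp Pq Pr; case=> -[|[|[|//]]] lt.
- by rewrite (_ : Ordinal lt = gp) //; apply: val_inj.
- by rewrite (_ : Ordinal lt = gq) //; apply: val_inj.
- by rewrite (_ : Ordinal lt = gr) //; apply: val_inj.
Qed.

(** * Consequences of the quaternion relations *)

Section QuaternionRelations.
Variables (G : groupType) (u v : G) (m : nat).
Hypotheses (uv : u ^+ m = v ^+ 2) (vuV : v * u * v^-1 = u^-1).

Lemma quat_mulX k : v * u ^+ k = u ^- k * v.
Proof.
have vu : v * u = u^-1 * v by rewrite -vuV mulgVK.
elim: k => [|k IH]; first by rewrite invg1 mulg1 mul1g.
by rewrite {1}expgSr mulgA IH -mulgA vu mulgA expgS invgM.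
Qed.

Lemma quat_mulXV k : v * u ^- k = u ^+ k * v.
Proof. by apply: (mulgI (u ^- k)); rewrite mulKg mulgA -quat_mulX mulgK. Qed.

(** The element [u ^+ m = v ^+ 2] commutes with [v], yet conjugation by [v] inverts it. *)
Lemma quat_expV : u ^- m = u ^+ m.
Proof. by apply: (mulIg v); rewrite -quat_mulX uv -expgS -expgSr. Qed.

Lemma quat_exp2 : u ^+ m.*2 = 1.
Proof. by rewrite -addnn expgnDr -{2}quat_expV mulgV. Qed.

End QuaternionRelations.

(** * Powers with exponents modulo [n] *)

Section PowersModulo.
Variables (G : groupType) (u : G) (n : nat).
Hypotheses (n1 : 1 < n) (un : u ^+ n = 1).

Lemma expg_modn k : u ^+ (k %% n) = u ^+ k.
Proof. by rewrite {2}(divn_eq k n) expgnDr mulnC expgnA un expg1n mul1g. Qed.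

Lemma expgZpD (i j : 'Z_n) : u ^+ (i + j)%R = u ^+ i * u ^+ j.
Proof. by rewrite /= {3}(Zp_cast n1) expg_modn expgnDr. Qed.

Lemma expgZp_nat k : u ^+ (k%:R : 'Z_n)%R = u ^+ k.
Proof. by rewrite val_Zp_nat // expg_modn. Qed.

Lemma expgZpB (i j : 'Z_n) : u ^+ (i - j)%R = u ^+ i * u ^- j.
Proof. by apply: (mulIg (u ^+ j)); rewrite mulgVK -expgZpD GRing.subrK. Qed.

End PowersModulo.

(** * Normal forms in generalised quaternion groups *)

Section Quaternion.
Variable m : nat.
Hypothesis m_gt0 : 0 < m.

Local Notation n := m.*2.
Local Notation X := ('Z_n * bool)%type.

Let n_gt1 : 1 < n.
Proof. by rewrite -(doubleS 0) leq_double. Qed.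

(** The pair [(k, e)] stands for u^k v^e. These maps are right multiplication by u and v: moving u
    past v inverts it, and v^2 contributes u^m. *)
Definition quat_act_u_fun (x : X) : X :=
  ((if x.2 then x.1 - 1 else x.1 + 1)%R, x.2).
Definition quat_act_v_fun (x : X) : X :=
  ((if x.2 then x.1 + m%:R else x.1)%R, ~~ x.2).

Lemma quat_act_u_inj : injective quat_act_u_fun.
Proof.
by move=> [k e] [l f] [+ ef]; rewrite {}ef; case: f => /GRing.addIr ->.
Qed.

Lemma quat_act_v_inj : injective quat_act_v_fun.
Proof.
move=> [k e] [l f] [+ /negb_inj ef]; rewrite {}ef.
by case: f => [/GRing.addIr|] ->.
Qed.

Definition quat_act_u : {perm X} := perm quat_act_u_inj.
Definition quat_act_v : {perm X} := perm quat_act_v_inj.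

Lemma quat_act_uX k x : (quat_act_u ^+ k) x =
  ((if x.2 then x.1 - k%:R else x.1 + k%:R)%R, x.2).
Proof.
rewrite permX; elim: k => [|k /= ->].
  by case: x => i [] /=; rewrite ?GRing.subr0 ?GRing.addr0.
rewrite permE /quat_act_u_fun /= -[k.+1]addn1 GRing.natrD.
by case: x.2; rewrite ?GRing.opprD GRing.addrA.
Qed.

Lemma Zp_natr_half : (m%:R + m%:R = 0 :> 'Z_n)%R.
Proof. by rewrite -GRing.natrD addnn pchar_Zp. Qed.

Lemma quat_act_uv : quat_act_u ^+ m = quat_act_v ^+ 2.
Proof.
(* When the second coordinate is true, u^m shifts by -m while v^2 shifts by m. *)
have mN : (- m%:R = m%:R :> 'Z_n)%R.
  by apply/eqP; rewrite GRing.eqr_oppLR -GRing.addr_eq0 Zp_natr_half.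
apply/permP => -[k e]; rewrite quat_act_uX expg2 permM.
rewrite !permE /quat_act_v_fun /=.
by case: e; rewrite /= ?mN.
Qed.

Lemma quat_act_conj :
  quat_act_v * quat_act_u * quat_act_v^-1 = quat_act_u^-1.
Proof.
(* Clearing inverses turns the goal into u v u = v. *)
apply: (mulIg quat_act_v); apply: (mulgI quat_act_u); rewrite mulgVK mulVKg.
apply/permP => -[k e]; rewrite !permM !permE /quat_act_u_fun /quat_act_v_fun /=.
case: e => /=; last by rewrite GRing.addrK.
by rewrite GRing.addrAC GRing.subrK.
Qed.

Definition quat_act (t : 'I_2) : {perm X} :=
  if t == gu then quat_act_u else quat_act_v.

Section QuatWord.
Variables (G : groupType) (u v : G).
Hypotheses (uv : u ^+ m = v ^+ 2) (vuV : v * u * v^-1 = u^-1).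

(** Defined in an arbitrary group, because the same words in p and q serve in [Tstar]. *)
Definition quat_word (x : X) : G := u ^+ x.1 * v ^+ x.2.

Lemma quat_word_u x : quat_word x * u = quat_word (quat_act_u x).
Proof.
have un := quat_exp2 uv vuV.
have u1 : u ^+ (1%R : 'Z_n) = u by exact: (expgZp_nat n_gt1 un 1).
case: x => k [] /=; rewrite permE /quat_word [X in _ = _ ^+ nat_of_ord X * _]/=.
  by rewrite expgZpB // u1 -!mulgA (quat_mulX vuV 1).
by rewrite expgZpD // !mulg1 u1.
Qed.

Lemma quat_word_v x : quat_word x * v = quat_word (quat_act_v x).
Proof.
have un := quat_exp2 uv vuV.
case: x => k [] /=; rewrite permE /quat_word [X in _ = _ ^+ nat_of_ord X * _]/=.
  by rewrite expgZpD // expgZp_nat // mulg1 -mulgA -expg2 uv.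
by rewrite mulg1.
Qed.

End QuatWord.

Definition quat_nf : X -> quaternion m := quat_word (qu m) (qv m).

Lemma quat_rels : qu m ^+ m = qv m ^+ 2 /\ qv m * qu m * (qv m)^-1 = (qu m)^-1.
Proof.
split.
  have /presented_rel : quaternion_rel m (free_gen gu ^+ m) (free_gen gv ^+ 2).
    by rewrite /quaternion_rel /rels_of !inE eqxx.
  by rewrite !multiplicativeX /= !free_lift_gen.
have /presented_rel : quaternion_rel m
    (free_gen gv * free_gen gu * (free_gen gv)^-1) (free_gen gu)^-1.
  by rewrite /quaternion_rel /rels_of !inE eqxx orbT.
by rewrite !gmulfM !multiplicativeV /= !free_lift_gen.
Qed.

Lemma quat_respects (G : groupType) (f : 'I_2 -> G) :
    f gu ^+ m = f gv ^+ 2 -> f gv * f gu * (f gv)^-1 = (f gu)^-1 ->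
  forall l r, quaternion_rel m l r -> free_lift f l = free_lift f r.
Proof.
move=> h1 h2 l r; rewrite /quaternion_rel /rels_of !inE.
case/orP=> /eqP[-> ->]; first by rewrite !multiplicativeX /= !free_lift_gen.
by rewrite !gmulfM !multiplicativeV /= !free_lift_gen.
Qed.

Lemma quat_nf_bij : bijective quat_nf.
Proof.
have [uv vu] := quat_rels.
apply: (@normal_form_bij _ (quaternion_rel m) X (0%R : 'Z_n, false)
  quat_act quat_nf).
- apply: quat_respects; first exact: quat_act_uv.
  exact: quat_act_conj.
- by rewrite /quat_nf /quat_word !expg0 mul1g.
- by move=> x; apply: I2_cases; [exact: quat_word_u | exact: quat_word_v].
- move=> F Fg [k e]; rewrite gmulfM !multiplicativeX !Fg permM quat_act_uX /=.
  rewrite GRing.add0r natr_Zp.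
  by case: e; rewrite ?expg0 ?perm1 ?expg1 ?permE.
Qed.

Lemma quaternion_order : has_order (quaternion m) (4 * m).
Proof.
have := has_order_card quat_nf_bij.
rewrite card_prod card_bool card_ord Zp_cast //.
by rewrite -muln2 -mulnA mulnC.
Qed.

Lemma quaternion_lift (G : groupType) (x y : G) :
    x ^+ m = y ^+ 2 -> y * x * y^-1 = x^-1 ->
  exists F : {multiplicative quaternion m -> G}, F (qu m) = x /\ F (qv m) = y.
Proof.
move=> h1 h2; pose f (t : 'I_2) := if t == gu then x else y.
have [F Ff] := presented_lift (@quat_respects _ f h1 h2).
by exists F; rewrite !Ff.
Qed.

End Quaternion.


(** The map sends u^k v^e to u^(2k) v^e, and doubling is injective from residues modulo 2m to
    residues modulo 4m. *)
Lemma quaternion_double (m : nat) : 0 < m ->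
  exists i : {multiplicative quaternion m -> quaternion m.*2},
    [/\ i (qu m) = qu m.*2 ^+ 2, i (qv m) = qv m.*2, injective i &
        normal_image i].
Proof.
move=> m0; have m20 : 0 < m.*2 by rewrite double_gt0.
have [uv vu] := quat_rels m.*2.
set u := qu _ in uv vu *; set v := qv _ in uv vu *.
have u2v : (u ^+ 2) ^+ m = v ^+ 2 by rewrite -expgnA mul2n.
have vu2 : v * u ^+ 2 * v^-1 = (u ^+ 2)^-1 by rewrite (quat_mulX vu) mulgK.
have [i [iu iv]] := quaternion_lift u2v vu2.
exists i; split=> //.
  have [nf' nfK nf'K] := quat_nf_bij m0.
  have inf (x : 'Z_m.*2 * bool) : i (quat_nf x) =
      quat_nf (m := m.*2) (x.1.*2%:R%R, x.2).
    rewrite gmulfM !multiplicativeX iu iv /quat_nf /quat_word expgZp_nat //.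
    + by rewrite -expgnA mul2n.
    + by rewrite -(doubleS 0) leq_double.
    + exact: quat_exp2 uv vu.
  move=> a b; rewrite -[a]nf'K -[b]nf'K !inf => /(bij_inj (quat_nf_bij m20)).
  case: (nf' a) (nf' b) => [k e] [l f] /= [+ ->].
  have n1 : 1 < m.*2 by rewrite -(doubleS 0) leq_double.
  have lt (x : 'Z_(m.*2)) : x.*2 < m.*2.*2.
    by rewrite ltn_double -{2}(Zp_cast n1).
  have n21 : 1 < m.*2.*2 by rewrite -(doubleS 0) leq_double.
  move=> /(congr1 (@nat_of_ord _)); rewrite !val_Zp_nat //.
  by rewrite !modn_small // => /double_inj /val_inj ->.
have uK : u * u ^+ 2 * u^-1 = u ^+ 2 by rewrite -expgS expgSr mulgK.
have uvK : u * v * u^-1 = u ^+ 2 * v.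
  by rewrite -mulgA (quat_mulXV vu 1) mulgA.
apply: normal_image_gen; apply: I2_cases; apply: I2_cases;
  rewrite -/(qu _) -/(qv _) ?iu ?iv.
- by exists (qu m); rewrite iu.
- by exists (qu m * qv m); rewrite gmulfM iu iv.
- by exists (qu m)^-1; rewrite multiplicativeV iu; exact: vu2.
- by exists (qv m); rewrite iv mulgK.
- by exists (qu m); rewrite iu expg2 mulKg.
- exists ((qu m)^-1 * qv m); rewrite gmulfM multiplicativeV iu iv.
  by rewrite -mulgA (quat_mulX vu 1) mulgA -invgM.
- exists (qu m)^-1; rewrite multiplicativeV iu.
  by rewrite -mulgA; apply: (mulgI v); rewrite mulVKg (quat_mulXV vu).
- by exists (qv m); rewrite iv mulVg mul1g.
Qed.

(** * The binary tetrahedral group *)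

Section TetrahedralRelations.
Variables (G : groupType) (p q r : G).
Hypotheses (pq2 : p ^+ 2 = q ^+ 2) (qpV : q * p * q^-1 = p^-1).
Hypotheses (rp : r * p = q * r) (rq : r * q = p * q * r).

Lemma tetra_pqp : p * q * p = q.
Proof. by rewrite -mulgA (quat_mulX qpV 1) mulVKg. Qed.

Lemma tetra_qpq : q * p * q = p.
Proof. by rewrite (quat_mulX qpV 1) -mulgA -expg2 -pq2 mulKg. Qed.

Lemma tetra_pq2 : (p * q) ^+ 2 = q ^+ 2.
Proof. by rewrite expg2 mulgA tetra_pqp. Qed.

(** Moving every r to the right gives (pq)^2 r^3. This links r^3 = 1 to the sphere relation in both
    directions. *)
Lemma tetra_pr3 : (p * r) ^+ 3 = q ^+ 2 * r ^+ 3.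
Proof.
rewrite -tetra_pq2 !expgS !expg0 !mulg1 !mulgA -(mulgA _ r p) rp.
by rewrite -!(mulgA _ r) rp !mulgA -(mulgA _ r q) rq !mulgA.
Qed.

End TetrahedralRelations.

Definition tr : Tstar := pgen Tstar_rel gr.

Lemma Tstar_rels :
  [/\ tp ^+ 2 = tq ^+ 2, tq * tp * tq^-1 = tp^-1, tr * tp = tq * tr,
      tr * tq = tp * tq * tr & tr ^+ 3 = 1].
Proof.
pose p := free_gen gp; pose q := free_gen gq; pose r := free_gen gr.
have /presented_rel : Tstar_rel (p ^+ 2) (q ^+ 2).
  by rewrite /Tstar_rel /rels_of !inE eqxx.
have /presented_rel : Tstar_rel (q * p * q^-1) p^-1.
  by rewrite /Tstar_rel /rels_of !inE eqxx ?orbT.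
have /presented_rel : Tstar_rel (r * p * r^-1) q.
  by rewrite /Tstar_rel /rels_of !inE eqxx ?orbT.
have /presented_rel : Tstar_rel (r * q * r^-1) (p * q).
  by rewrite /Tstar_rel /rels_of !inE eqxx ?orbT.
have /presented_rel : Tstar_rel (r ^+ 3) 1.
  by rewrite /Tstar_rel /rels_of !inE eqxx ?orbT.
rewrite !(gmulfM, multiplicativeX, multiplicativeV, multiplicative1) /=.
rewrite !free_lift_gen => r3 rq rp qp pq.
by split=> //; [rewrite -[RHS]/(tq * tr) -[tq]rp|rewrite -[tp * tq]rq];
  rewrite mulgVK.
Qed.

Lemma Tstar_respects (G : groupType) (f : 'I_3 -> G) :
    f gp ^+ 2 = f gq ^+ 2 -> f gq * f gp * (f gq)^-1 = (f gp)^-1 ->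
    f gr * f gp = f gq * f gr -> f gr * f gq = f gp * f gq * f gr ->
    f gr ^+ 3 = 1 ->
  forall l r, Tstar_rel l r -> free_lift f l = free_lift f r.
Proof.
move=> h1 h2 h3 h4 h5 l r; rewrite /Tstar_rel /rels_of !inE.
do 4?[case/orP]; move=> /eqP[-> ->];
  rewrite !(gmulfM, multiplicativeX, multiplicativeV, multiplicative1) /=;
  by rewrite ?free_lift_gen // ?h3 ?h4 mulgK.
Qed.

Lemma Tstar_lift (G : groupType) (x y z : G) :
    x ^+ 2 = y ^+ 2 -> y * x * y^-1 = x^-1 -> z * x = y * z ->
    z * y = x * y * z -> z ^+ 3 = 1 ->
  exists F : {multiplicative Tstar -> G}, [/\ F tp = x, F tq = y & F tr = z].
Proof.
move=> h1 h2 h3 h4 h5.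
pose f (t : 'I_3) := if t == gp then x else if t == gq then y else z.
have [F Ff] := presented_lift (@Tstar_respects _ f h1 h2 h3 h4 h5).
by exists F; rewrite !Ff.
Qed.

(** * Normal forms in the binary tetrahedral group *)

Section Tetrahedral.

Local Notation X := ('Z_4 * bool)%type.
Local Notation U := (@quat_act_u 2).
Local Notation V := (@quat_act_v 2).

(* Conjugation by [r] permutes [p], [q] and [pq] cyclically; [tetra_axis] lists
   the right translations by these three elements. *)
Definition tetra_axis (c : 'Z_3) : {perm X} := nth 1 [:: U; V; U * V] c.

(** For [c = 0] this defines the third axis; the other cases are qpq = p and pqp = q. *)
Lemma tetra_axisM c :
  tetra_axis (c + 1 + 1)%R = tetra_axis c * tetra_axis (c + 1)%R.
Proof.
have pqp := tetra_pqp (@quat_act_conj 2).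
have qpq := tetra_qpq (quat_act_uv (m := 2) isT) (@quat_act_conj 2).
by case: c => -[|[|[|//]]] lt; rewrite /tetra_axis //= ?mulgA ?pqp ?qpq.
Qed.


(** The pair [(x, c)] stands for w r^c, where w is the word in p and q coded by [x]. Moving p or q
    leftwards past r^c conjugates it, so it acts on w through an axis depending on [c]. *)
Definition tetra_act_r_fun (x : X * 'Z_3) := (x.1, (x.2 + 1)%R).
Definition tetra_act_h_fun (h : 'Z_3 -> {perm X}) (x : X * 'Z_3) :=
  (h x.2 x.1, x.2).

Lemma tetra_act_r_inj : injective tetra_act_r_fun.
Proof.
move=> [x c] [y d] e; have /= -> := congr1 fst e.
by have /= /GRing.addIr -> := congr1 snd e.
Qed.

Lemma tetra_act_h_inj h : injective (tetra_act_h_fun h).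
Proof. by move=> [x c] [y d] [+ ecd]; rewrite {}ecd => /perm_inj ->. Qed.

Definition tetra_act_r : {perm X * 'Z_3} := perm tetra_act_r_inj.
Definition tetra_act_h h : {perm X * 'Z_3} := perm (@tetra_act_h_inj h).
Definition tetra_act_p := tetra_act_h tetra_axis.
Definition tetra_act_q := tetra_act_h (fun c => tetra_axis (c + 1)%R).

Lemma tetra_act_rE x c : tetra_act_r (x, c) = (x, (c + 1)%R).
Proof. by rewrite permE. Qed.

Lemma tetra_act_hE h x c : tetra_act_h h (x, c) = (h c x, c).
Proof. by rewrite permE. Qed.

Lemma tetra_act_hM h k :
  tetra_act_h h * tetra_act_h k = tetra_act_h (fun c => h c * k c).
Proof. by apply/permP => -[x c]; rewrite permM !tetra_act_hE permM. Qed.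

Lemma tetra_act_hX h n x c : (tetra_act_h h ^+ n) (x, c) = ((h c ^+ n) x, c).
Proof. by rewrite !permX; elim: n => //= n ->; rewrite tetra_act_hE. Qed.

Lemma tetra_act_rX n x : (tetra_act_r ^+ n) (x, 0%R) = (x, (n%:R)%R).
Proof.
by rewrite permX; elim: n => //= n ->; rewrite tetra_act_rE GRing.mulrSr.
Qed.

Lemma tetra_act_rels :
  [/\ tetra_act_p ^+ 2 = tetra_act_q ^+ 2,
      tetra_act_q * tetra_act_p * tetra_act_q^-1 = tetra_act_p^-1,
      tetra_act_r * tetra_act_p = tetra_act_q * tetra_act_r,
      tetra_act_r * tetra_act_q = tetra_act_p * tetra_act_q * tetra_act_r &
      tetra_act_r ^+ 3 = 1].
Proof.
have uv := quat_act_uv (m := 2) isT; have vu := @quat_act_conj 2.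
have axis2 c : tetra_axis c ^+ 2 = V ^+ 2.
  by case: c => -[|[|[|//]]] lt //; exact: tetra_pq2 vu.
(* Each axis is inverted by its successor; this is that relation without inverses. *)
have pqp c : tetra_axis c * tetra_axis (c + 1)%R * tetra_axis c =
    tetra_axis (c + 1)%R.
  case: c => -[|[|[|//]]] lt; rewrite /tetra_axis /= ?mulgA.
  - exact: tetra_pqp vu.
  - by rewrite (tetra_qpq uv vu).
  - by rewrite (tetra_pqp vu) (tetra_qpq uv vu).
split.
- by rewrite !expg2 !tetra_act_hM; apply/permP => -[x c];
  rewrite !tetra_act_hE -!expg2 !axis2.
- apply: (mulIg tetra_act_q); apply: (mulgI tetra_act_p).
  rewrite mulgVK mulVKg !tetra_act_hM; apply/permP => -[x c].
  by rewrite !tetra_act_hE mulgA pqp.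
- by apply/permP => -[x c]; rewrite !permM !(tetra_act_rE, tetra_act_hE).
- apply/permP => -[x c]; rewrite tetra_act_hM !permM.
  rewrite !(tetra_act_rE, tetra_act_hE).
  by rewrite tetra_axisM.
- apply/permP => -[x c]; rewrite permX /= !tetra_act_rE perm1.
  rewrite -!GRing.addrA; congr (_, _).
  by apply: val_inj; case: c => -[|[|[|//]]].
Qed.

Definition tetra_act (t : 'I_3) : {perm X * 'Z_3} :=
  if t == gp then tetra_act_p else if t == gq then tetra_act_q else tetra_act_r.

Definition tetra_nf (x : X * 'Z_3) : Tstar :=
  quat_word (m := 2) tp tq x.1 * tr ^+ x.2.

Lemma tetra_nf_bij : bijective tetra_nf.
Proof.
have [pq qp rp rq r3] := Tstar_rels.
have nfp (x : X) := quat_word_u (m := 2) isT pq qp x.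
have nfq (x : X) := quat_word_v (m := 2) isT pq qp x.
have [apq aqp arp arq ar3] := tetra_act_rels.
have axis1 : tetra_axis (0 + 1)%R = V by [].
(* [g c] is r^c p r^-c, whose right translation is [tetra_axis c]; since q = r p r^-1, conjugating q
   instead gives [g (c + 1)]. *)
pose g (c : 'Z_3) := nth 1 [:: tp; tq; tp * tq] c.
have nfaxis (x : X) c : quat_word (m := 2) tp tq x * g c =
    quat_word (m := 2) tp tq (tetra_axis c x).
  by case: c => -[|[|[|//]]] lt;
    rewrite /tetra_axis /g /= ?mulgA ?permM ?nfp ?nfq.
have rpX (c : 'Z_3) : tr ^+ c * tp = g c * tr ^+ c.
  case: c => -[|[|[|//]]] lt; rewrite /g /= ?expg0 ?mulg1 ?mul1g ?expg1 //.
  by rewrite -mulgA rp mulgA rq mulgA.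
have rqX (c : 'Z_3) : tr ^+ c * tq = g (c + 1)%R * tr ^+ c.
  case: c => -[|[|[|//]]] lt; rewrite /g /= ?expg0 ?mulg1 ?mul1g ?expg1 //.
  by rewrite -mulgA rq !mulgA rp -(mulgA _ tr tq) rq !mulgA (tetra_qpq pq qp).
apply: (@normal_form_bij _ Tstar_rel (X * 'Z_3)%type
  ((0%R : 'Z_4, false), 0%R : 'Z_3) tetra_act tetra_nf).
- exact: Tstar_respects.
- by rewrite /tetra_nf /quat_word !expg0 !mul1g.
- move=> [x c]; apply: I3_cases; rewrite /tetra_nf -[LHS]mulgA /tetra_act /=.
  + by rewrite tetra_act_hE rpX [LHS]mulgA nfaxis.
  + by rewrite tetra_act_hE rqX [LHS]mulgA nfaxis.
  + by rewrite tetra_act_rE (expgZpD _ r3).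
- move=> F Fg [[k e] c]; rewrite !gmulfM !multiplicativeX !Fg !permM /=.
  rewrite tetra_act_hX tetra_act_hX tetra_act_rX natr_Zp /=.
  have -> : (tetra_axis 0%R ^+ k) (0%R, false) = (k, false).
    rewrite [LHS](@quat_act_uX 2) /= GRing.add0r.
    by congr (_, _); exact: natr_Zp.
  rewrite axis1.
  by case: e; rewrite ?expg0 ?perm1 ?expg1 ?permE.
Qed.

Lemma Tstar_order : has_order Tstar 24.
Proof.
have := has_order_card tetra_nf_bij.
by rewrite !card_prod card_bool !card_ord.
Qed.

End Tetrahedral.

(** * The quaternion subgroup of the binary tetrahedral group *)

Lemma quat_word_morph (m : nat) (G : groupType)
    (F : {multiplicative quaternion m -> G}) x :
  F (quat_nf x) = quat_word (F (qu m)) (F (qv m)) x.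
Proof. by rewrite gmulfM !multiplicativeX. Qed.

(** Injectivity holds because normal forms of [Q8] go to the tetrahedral normal forms with
    r-exponent 0. *)
Lemma Q8_Tstar :
  exists j : {multiplicative Q8 -> Tstar},
    [/\ j (qu 2) = tp, j (qv 2) = tq, injective j & normal_image j].
Proof.
have [pq qp rp rq r3] := Tstar_rels.
have [j [jp jq]] := quaternion_lift pq qp.
exists j; split=> //.
  have [nf' nfK nf'K] := @quat_nf_bij 2 isT.
  have jnf x : j (quat_nf x) = tetra_nf (x, 0%R).
    by rewrite quat_word_morph jp jq /tetra_nf mulg1.
  move=> a b; rewrite -[a]nf'K -[b]nf'K !jnf.
  by move/(bij_inj tetra_nf_bij)/(congr1 fst) => /= ->.
(* Conjugation by r^-1 therefore sends p to pq. *)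
have pK : tr * (tp * tq) = tp * tr.
  by rewrite mulgA rp -mulgA rq !mulgA (tetra_qpq pq qp).
apply: (@normal_image_gen _ _ (quaternion_rel 2) Tstar_rel j).
  apply: I3_cases; apply: I2_cases; rewrite ?jp ?jq.
  - by exists (qu 2); rewrite jp mulgK.
  - exists (qu 2 ^+ 2 * qv 2).
    rewrite gmulfM multiplicativeX jp jq -mulgA; apply: (mulgI tp^-1).
    by rewrite !mulKg -mulgA mulKg (quat_mulXV qp 1).
  - by exists (qu 2)^-1; rewrite multiplicativeV jp; exact: qp.
  - by exists (qv 2); rewrite jq mulgK.
  - by exists (qv 2); rewrite jq -/tr rp mulgK.
  - exists (qu 2 * qv 2); rewrite gmulfM jp jq.
    by rewrite -/tr rq mulgK.
apply: I3_cases; apply: I2_cases; rewrite ?jp ?jq.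
- by exists (qu 2); rewrite jp mulVg mul1g.
- exists ((qu 2)^-1 ^+ 2 * qv 2).
  rewrite gmulfM multiplicativeX multiplicativeV jp jq.
  by rewrite -mulgA (quat_mulX qp 1) mulgA.
- exists (qu 2)^-1; rewrite multiplicativeV jp; apply: (mulgI tq).
  by rewrite -mulgA mulVKg (quat_mulXV qp 1).
- by exists (qv 2); rewrite jq mulVg mul1g.
- exists (qu 2 * qv 2); rewrite gmulfM jp jq.
  by rewrite -[RHS](mulKg tr) pK mulgA.
- by exists (qu 2); rewrite jp -[RHS](mulKg tr) rp mulgA.
Qed.

(** * The two mutually inverse homomorphisms *)

Section BraidRelations.
Variables (G : groupType) (a b c u v p r : G).
Hypotheses (ac : a * c = c * a) (aba : a * b * a = b * a * b).
Hypotheses (bcb : b * c * b = c * b * c) (abc2ba : a * b * c ^+ 2 * b * a = 1).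

Hypotheses (uE : u = a * b * c) (vE : v = u * (a * b * a)).
Hypotheses (pE : p = u * u) (rE : r = (u * c * p)^-1).

Let uV : u^-1 = c * b * a.
Proof. by apply: mulg1_eq; rewrite -abc2ba expg2 ?uE !mulgA. Qed.

Lemma braid_conj12 : u * a = b * u.
Proof. by rewrite uE -mulgA -ac !mulgA aba. Qed.

Lemma braid_conj23 : u * b = c * u.
Proof. by rewrite uE -!mulgA [b * _]mulgA bcb !mulgA ac. Qed.

Let vE' : v = a * b * a * u^-1.
Proof. by rewrite uV vE uE !mulgA -(mulgA _ a c) ac !mulgA. Qed.

(** As the half twist, v exchanges a and c under conjugation and fixes b. *)
Let va : v * a = c * v.
Proof.
rewrite vE [RHS]mulgA -braid_conj23 -!mulgA; congr (u * _).
by rewrite !mulgA aba.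
Qed.

Let vb : v * b = b * v.
Proof.
rewrite vE [RHS]mulgA -braid_conj12 -!mulgA; congr (u * (a * _)).
by rewrite !mulgA aba.
Qed.

Let vc : v * c = a * v.
Proof.
have uVc : u^-1 * c = b * u^-1.
  by apply: (mulgI u); rewrite mulVKg mulgA braid_conj23 mulgK.
by rewrite vE' -mulgA uVc -!mulgA; congr (a * _); rewrite !mulgA aba.
Qed.

Let uu : a * b * a * (c * b * c) = u * u.
Proof. by rewrite uE !mulgA -(mulgA _ a c) ac !mulgA. Qed.

Let u2a : u * u * a = c * (u * u).
Proof. by rewrite -mulgA braid_conj12 mulgA braid_conj23 mulgA. Qed.

(** Conjugation by v turns the word abc into cba, which is u^-1 by the sphere relation. *)
Lemma braid_quat_conj : v * u * v^-1 = u^-1.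
Proof.
apply: (mulIg v); rewrite mulgVK uV [in LHS]uE !mulgA va.
by rewrite -(mulgA _ v b) vb -!mulgA vc.
Qed.

(** Moving v leftwards past aba gives v^2 = u v (cbc) = u^2 (aba)(cbc), and (aba)(cbc) = u^2. *)
Lemma braid_quat_pow : u ^+ 4 = v ^+ 2.
Proof.
have abav : a * b * a * v = v * (c * b * c).
  by rewrite -!mulgA -vc !mulgA -(mulgA _ b v) -vb !mulgA -vc.
by rewrite expg2 {1}vE -mulgA abav mulgA vE -!(mulgA u) uu !expgS mulg1.
Qed.

Let va_p : v * a * p = a.
Proof.
apply: (mulIg (p^-1)); rewrite mulgK va vE' pE !invgM uV !mulgA.
by rewrite -ac.
Qed.

Let rV : r^-1 = u * c * p.
Proof. by rewrite rE invgK. Qed.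

(** The left side is (uc)^-1, and u c b a = 1 is the sphere relation. *)
Let pr : p * r = b * a.
Proof.
rewrite rE invgM mulVKg; apply: mulg1_eq.
by rewrite -abc2ba expg2 ?uE !mulgA.
Qed.

Let vp : v * p = p^-1 * v.
Proof.
have := quat_mulX braid_quat_conj 2.
by rewrite -[u ^+ 2]/(u * u) -pE.
Qed.

Let vpV : v * p^-1 = p * v.
Proof. by apply: (mulgI p^-1); rewrite mulKg mulgA -vp mulgK. Qed.

Let pp : p * p = v * v.
Proof. by rewrite -(expg2 v) -braid_quat_pow pE !expgS mulg1 !mulgA. Qed.

Let p4 : p^-1 = p * p * p.
Proof.
apply: mulg1_eq; have := quat_exp2 braid_quat_pow braid_quat_conj.
by rewrite pE !expgS mulg1 !mulgA.
Qed.

(** From p a = c p, since p^2 = v^2 commutes with a. *)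
Let pc : p * c = a * p.
Proof.
have zc : p * p * a = a * (p * p) by rewrite pp -mulgA va mulgA vc mulgA.
by apply: (mulIg p); rewrite -[LHS]mulgA {2}pE -u2a -pE mulgA zc mulgA.
Qed.

Lemma braid_rp : r * p = v * r.
Proof.
(* With r^-1 = u c p the goal is p r^-1 = r^-1 v. The sides become u a p^2 and u v a p^-1, equal by
   v a = a p^-1 and p^4 = 1. *)
apply: (mulgI r^-1); apply: (mulIg r^-1); rewrite mulKg -[RHS]mulgA mulgK rV.
rewrite -[RHS]mulgA -vpV !mulgA -[in RHS](mulgA u) -va.
have -> : p * u = u * p by rewrite pE mulgA.
rewrite -(mulgA u p c) pc -!mulgA; congr (u * _).
have va' : v * a = a * p^-1 by rewrite -[in RHS]va_p mulgK.
by rewrite [RHS]mulgA va' -mulgA {1}p4 mulgK.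
Qed.

Lemma braid_rq : r * v = p * v * r.
Proof.
apply: (mulgI r^-1); apply: (mulIg r^-1); rewrite mulKg -[RHS]mulgA mulgK rV.
have vu : v * u = u^-1 * v by rewrite -braid_quat_conj mulgVK.
(* The goal v r^-1 = r^-1 p v becomes a p^-1 = p c p^2, which follows from p c = a p and p^-1 =
   p^3. *)
rewrite !mulgA vu -(mulgA _ v c) vc mulgA -(mulgA _ v p) vp mulgA.
congr (_ * v); apply: (mulgI u); rewrite -!mulgA mulVKg.
by rewrite [u * (u * _)]mulgA -pE mulgA pc p4 -!mulgA.
Qed.

(** Compare (pr)^3 = v^2 r^3 with (ba)^3 = (aba)^2 = v^2. *)
Lemma braid_r3 : r ^+ 3 = 1.
Proof.
have vpc : v * p * v^-1 = p^-1 by rewrite vp mulgK.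
have := tetra_pr3 vpc braid_rp braid_rq.
have abaV : a * b * a = v * u by rewrite vE' mulgVK.
have ba3 : (b * a) ^+ 3 = a * b * a * (a * b * a).
  by rewrite {1}aba !expgS mulg1 !mulgA.
by rewrite pr ba3 {1}abaV -mulgA -vE -expg2 -[LHS]mulg1 => /mulgI.
Qed.

End BraidRelations.

(** * Braid relations inside the amalgam *)

(* The elements [x], [y], [z] are the inverses of the images of the standard
   generators of the braid group: taking inverses makes these images positive
   words, and the braid relations are invariant under inversion. *)
Section AmalgamRelations.
Variables (G : groupType) (u v p r : G).
Hypotheses (uv : u ^+ 4 = v ^+ 2) (vuV : v * u * v^-1 = u^-1) (pE : p = u * u).
Hypotheses (rp : r * p = v * r) (rv : r * v = p * v * r) (r3 : r ^+ 3 = 1).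

Variables (x y z : G).
Hypotheses (xE : x = r * (u * p)) (yE : y = u * r * p) (zE : z = p * r * u).

Let up : u * p = p * u.
Proof. by rewrite pE mulgA. Qed.

Let pp : p * p = v * v.
Proof. by rewrite -(expg2 v) -uv pE !expgS mulg1 !mulgA. Qed.

Let p4 : p * p * (p * p) = 1.
Proof.
have := quat_exp2 uv vuV; by rewrite pE !expgS mulg1 !mulgA.
Qed.

Let vpV : v * p * v^-1 = p^-1.
Proof.
by have := quat_mulX vuV 2; rewrite -[u ^+ 2]/(u * u) -pE => ->; rewrite mulgK.
Qed.

Let rz : r * (p * p) = p * p * r.
Proof. by rewrite mulgA rp -mulgA rp mulgA pp. Qed.

Let rrr : r * r * r = 1.
Proof. by rewrite -r3 !expgS mulg1 !mulgA. Qed.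

Let uppu : u * (p * p) = p * p * u.
Proof. by rewrite mulgA up -mulgA up mulgA. Qed.

(** As u p u = p^2 commutes with r, the product is r^3 p^4 u. *)
Lemma amalgam_xyz : x * y * z = u.
Proof.
rewrite xE yE zE.
have -> : r * (u * p) * (u * r * p) * (p * r * u) =
    r * (p * p) * (r * (p * p)) * r * u.
  by rewrite !mulgA -(mulgA r u p) up !mulgA -(mulgA (r * p) u u) -pE.
by rewrite {2}rz -(mulgA r (p * p)) (mulgA (p * p) _ r) p4 mul1g rrr mul1g.
Qed.

(** The word z y x u collapses to (pr)^3 p^2, and (pr)^3 = v^2 = p^2. *)
Lemma amalgam_zyx : z * y * x = u^-1.
Proof.
apply: (mulIg u); rewrite mulVg xE yE zE.
have -> : p * r * u * (u * r * p) * (r * (u * p)) * u =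
    (p * r) ^+ 3 * (p * p).
  by rewrite !expgS mulg1 up !mulgA -(mulgA (p * r) u u) -pE -!mulgA -pE.
by rewrite (tetra_pr3 vpV rp rv) r3 mulg1 expg2 -pp p4.
Qed.

(** Both sides reduce to p^2 v r u^-1 r u. *)
Lemma amalgam_xz : x * z = z * x.
Proof.
have uV : u * v = v * u^-1 by rewrite (quat_mulXV vuV 1).
have rupp : r * (u * (p * p)) = p * p * v * r * u^-1.
  apply: (mulIg u); rewrite mulgVK uppu -!mulgA -pE !mulgA.
  by rewrite -(mulgA r p p) rz -(mulgA _ r p) rp !mulgA.
rewrite xE zE.
have -> : r * (u * p) * (p * r * u) = r * (u * (p * p)) * r * u.
  by rewrite !mulgA.
rewrite rupp up !mulgA -(mulgA _ r p) rp -!mulgA [u * (v * _)]mulgA uV.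
by rewrite -!mulgA [r * (v * _)]mulgA rv -!mulgA.
Qed.

(** The word reduces to p^2 v u, and p^2 = v^-2. Inverted, the identity recovers v as u times a
    braid word. *)
Lemma amalgam_xyx : x * y * x = v^-1 * u.
Proof.
have vV : v^-1 = p * p * v.
  by apply: mulg1_eq; rewrite {1}pp !mulgA -(mulgA (v * v)) -pp p4.
rewrite xE yE.
have -> : r * (u * p) * (u * r * p) * (r * (u * p)) =
    r * (p * p) * (r * p) * r * (u * p).
  by rewrite !mulgA -(mulgA r u p) up !mulgA -(mulgA (r * p) u u) -pE.
have vp : v * p = p^-1 * v by rewrite (quat_mulX vpV 1).
rewrite rz rp vV -!mulgA; congr (p * (p * _)).
rewrite mulgA rv -!mulgA (mulgA r r) (mulgA (r * r)) rrr mul1g up (mulgA v) vp.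
by rewrite -mulgA mulVKg.
Qed.

End AmalgamRelations.

(** * Universal property of the amalgamated product *)

Section AmalgamTheory.
Variables (H G1 G2 : groupType).
Variables (i : {multiplicative H -> G1}) (j : {multiplicative H -> G2}).

Definition amalgam_inl (a : G1) : amalgam i j := pgen (amalgam_rel i j) (inl a).
Definition amalgam_inr (b : G2) : amalgam i j := pgen (amalgam_rel i j) (inr b).

Let amalgam_inlM : {morph amalgam_inl : a b / a * b}.
Proof.
move=> a b; have := presented_rel (AmalgamL i j a b).
by rewrite gmulfM /= !free_lift_gen.
Qed.

Let amalgam_inrM : {morph amalgam_inr : a b / a * b}.
Proof.
move=> a b; have := presented_rel (AmalgamR i j a b).
by rewrite gmulfM /= !free_lift_gen.
Qed.

HB.instance Definition _ := isMultiplicative.Build _ _ amalgam_inl amalgam_inlM.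
HB.instance Definition _ := isMultiplicative.Build _ _ amalgam_inr amalgam_inrM.

Lemma amalgam_glue h : amalgam_inl (i h) = amalgam_inr (j h).
Proof.
by have := presented_rel (AmalgamGlue i j h); rewrite !free_lift_gen.
Qed.

Lemma amalgam_lift (G : groupType) (f1 : {multiplicative G1 -> G})
    (f2 : {multiplicative G2 -> G}) : (forall h, f1 (i h) = f2 (j h)) ->
  exists F : {multiplicative amalgam i j -> G},
    (forall a, F (amalgam_inl a) = f1 a) /\
    (forall b, F (amalgam_inr b) = f2 b).
Proof.
move=> f12.
pose f (x : G1 + G2) := match x with inl a => f1 a | inr b => f2 b end.
have [F Ff] : exists F : {multiplicative amalgam i j -> G},
    forall x, F (pgen _ x) = f x.
  apply: presented_lift => l r [a b|a b|h].
  - by rewrite !gmulfM /= !free_lift_gen /= gmulfM.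
  - by rewrite !gmulfM /= !free_lift_gen /= gmulfM.
  - by rewrite !free_lift_gen /= f12.
by exists F; split=> x; rewrite Ff.
Qed.

Lemma amalgam_ext (G : groupType) (f g : {multiplicative amalgam i j -> G}) :
    (forall a, f (amalgam_inl a) = g (amalgam_inl a)) ->
    (forall b, f (amalgam_inr b) = g (amalgam_inr b)) ->
  f =1 g.
Proof.
by move=> fg1 fg2; apply: presented_ext => -[a|b]; [exact: fg1|exact: fg2].
Qed.

End AmalgamTheory.

(** * Universal property of the braid group and translation between the two sets of generators *)

Definition sigma1 : B4S2 := pgen B4S2_rel s1.
Definition sigma2 : B4S2 := pgen B4S2_rel s2.
Definition sigma3 : B4S2 := pgen B4S2_rel s3.

Lemma B4S2_rels :
  [/\ sigma1 * sigma3 = sigma3 * sigma1,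
      sigma1 * sigma2 * sigma1 = sigma2 * sigma1 * sigma2,
      sigma2 * sigma3 * sigma2 = sigma3 * sigma2 * sigma3 &
      sigma1 * sigma2 * sigma3 ^+ 2 * sigma2 * sigma1 = 1].
Proof.
pose a := free_gen s1; pose b := free_gen s2; pose c := free_gen s3.
have /presented_rel : B4S2_rel (a * c) (c * a).
  by rewrite /B4S2_rel /rels_of !inE eqxx.
have /presented_rel : B4S2_rel (a * b * a) (b * a * b).
  by rewrite /B4S2_rel /rels_of !inE eqxx ?orbT.
have /presented_rel : B4S2_rel (b * c * b) (c * b * c).
  by rewrite /B4S2_rel /rels_of !inE eqxx ?orbT.
have /presented_rel : B4S2_rel (a * b * c ^+ 2 * b * a) 1.
  by rewrite /B4S2_rel /rels_of !inE eqxx ?orbT.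
rewrite !(gmulfM, multiplicativeX, multiplicative1) /=.
by rewrite !free_lift_gen.
Qed.

Lemma B4S2_lift (G : groupType) (x y z : G) :
    x * z = z * x -> x * y * x = y * x * y -> y * z * y = z * y * z ->
    x * y * z ^+ 2 * y * x = 1 ->
  exists F : {multiplicative B4S2 -> G},
    [/\ F sigma1 = x, F sigma2 = y & F sigma3 = z].
Proof.
move=> h1 h2 h3 h4.
pose f (t : 'I_3) := if t == s1 then x else if t == s2 then y else z.
have [F Ff] : exists F : {multiplicative B4S2 -> G},
    forall t, F (pgen _ t) = f t.
  apply: presented_lift => l r; rewrite /B4S2_rel /rels_of !inE.
  do 3?[case/orP]; move=> /eqP[-> ->];
    rewrite !(gmulfM, multiplicativeX, multiplicative1) /=;
    by rewrite ?free_lift_gen.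
by exists F; rewrite !Ff.
Qed.

(** The first four identities define the map out of the braid group; the last three show that the
    backward formulas return u, v and r. *)
Lemma braid_of_amalgam (G : groupType) (u v p r x y z : G) :
    u ^+ 4 = v ^+ 2 -> v * u * v^-1 = u^-1 -> p = u * u -> r * p = v * r ->
    r * v = p * v * r -> r ^+ 3 = 1 ->
    x = (r * (u * p))^-1 -> y = (u * r * p)^-1 -> z = (p * r * u)^-1 ->
  [/\ x * z = z * x, x * y * x = y * x * y, y * z * y = z * y * z &
      x * y * z ^+ 2 * y * x = 1] /\
  [/\ u = x * y * z, v = u * (x * y * x) & r = (u * z * p)^-1].
Proof.
move=> uv vu pE rp rv r3 xE yE zE.
have up : u * p = p * u by rewrite pE mulgA.
have xV : x^-1 = r * (u * p) by rewrite xE invgK.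
have yV : y^-1 = u * r * p by rewrite yE invgK.
have zV : z^-1 = p * r * u by rewrite zE invgK.
have zyx : z * y * x = u^-1.
  by rewrite -(amalgam_xyz uv vu pE rp r3 xV yV zV) !invgM !invgK mulgA.
have xyz : x * y * z = u.
  apply: invg_inj; rewrite -(amalgam_zyx uv vu pE rp rv r3 xV yV zV).
  by rewrite !invgM mulgA.
have xz : x * z = z * x.
  by apply: invg_inj; rewrite !invgM (amalgam_xz uv vu pE rp rv xV zV).
have xyx : x * y * x = u^-1 * v.
  apply: invg_inj; rewrite !invgM invgK mulgA.
  exact: (amalgam_xyx uv vu pE rp rv r3 xV yV).
have upV : u * p^-1 = u^-1 by rewrite pE invgM mulVKg.
have pVu : p^-1 * u = u^-1 by rewrite pE invgM mulgVK.
have ux : u * x = y * u.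
  by rewrite xE yE up !invgM -!mulgA mulVKg mulVg mulg1.
have uy : u * y = z * u.
  by rewrite yE zE !invgM mulgA upV -!mulgA pVu.
do 2?split=> //.
(* Multiplied by z on the right, the two sides are u x and y u. *)
- apply: (mulIg z); rewrite -(mulgA _ x z) xz !mulgA xyz ux.
  by rewrite -xyz !mulgA.
(* Multiplied by x on the left, the two sides are u y and z u. *)
- by apply: (mulgI x); rewrite !mulgA xyz uy -xyz !mulgA -xz.
- by rewrite expg2 !mulgA xyz -!mulgA [z * _]mulgA zyx mulgV.
- by rewrite xyx mulVKg.
- by rewrite zE (invgM (p * r)) (invgM p) mulVKg mulgVK invgK.
Qed.

(** As r^-1 = u c p, the three elements are the conjugates of c by u^-2, u^-1 and 1. *)
Lemma amalgam_of_braid (G : groupType) (a b c u p r : G) :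
    u * a = b * u -> u * b = c * u -> p = u * u -> r = (u * c * p)^-1 ->
  [/\ (r * (u * p))^-1 = a, (u * r * p)^-1 = b & (p * r * u)^-1 = c].
Proof.
move=> ua ub pE ->; rewrite !invgM !invgK; split.
- apply: (mulgI p); rewrite -!mulgA mulVKg mulKg.
  by rewrite pE -[RHS]mulgA ua !mulgA ub.
- by apply: (mulgI p); rewrite mulVKg pE -[RHS]mulgA ub !mulgA mulgK.
- by rewrite mulgK mulKg.
Qed.

Theorem proposition37 :
  [/\ has_order Q8 8, has_order Q16 16 & has_order Tstar 24] /\
  exists (i : {multiplicative Q8 -> Q16}) (j : {multiplicative Q8 -> Tstar}),
    [/\ i (qu 2) = qu 4 ^+ 2, i (qv 2) = qv 4, injective i & normal_image i] /\
    [/\ j (qu 2) = tp, j (qv 2) = tq, injective j & normal_image j] /\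
    isomorphic B4S2 (amalgam i j).
Proof.
split.
  split; [exact: (@quaternion_order 2) | exact: (@quaternion_order 4) |].
  exact: Tstar_order.
have [i [iu iv injI nI]] := @quaternion_double 2 isT.
have [j [jp jq injJ nJ]] := Q8_Tstar.
exists i, j; do 2!split=> //.
pose A : groupType := amalgam i j.
pose u : A := amalgam_inl i j (qu 4); pose v : A := amalgam_inl i j (qv 4).
pose p : A := amalgam_inr i j tp; pose r : A := amalgam_inr i j tr.
have vE : v = amalgam_inr i j tq by rewrite -jq -amalgam_glue iv.
have pE : p = u * u.
  by rewrite /p -jp -amalgam_glue iu expg2 gmulfM.
have [uv vu] := quat_rels 4; have [pq qp rp rq r3] := Tstar_rels.
have [] := @braid_of_amalgam A u v p r _ _ _ _ _ pE _ _ _ erefl erefl erefl.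
- by have := congr1 (amalgam_inl i j) uv; rewrite !multiplicativeX.
- by have := congr1 (amalgam_inl i j) vu; rewrite !gmulfM !multiplicativeV.
- by have := congr1 (amalgam_inr i j) rp; rewrite !gmulfM /= -vE.
- by have := congr1 (amalgam_inr i j) rq; rewrite !gmulfM /= -vE.
- have := congr1 (amalgam_inr i j) r3.
  by rewrite multiplicativeX multiplicative1.
set x := (r * (u * p))^-1; set y := (u * r * p)^-1; set z := (p * r * u)^-1.
case=> xz xyx yzy xyzzyx [uE vE' rE].
have [F [F1 F2 F3]] := B4S2_lift xz xyx yzy xyzzyx.
have [sac saba sbcb srel] := B4S2_rels.
(* The inverse homomorphism will send u, v, p, r to these words. *)
pose U := sigma1 * sigma2 * sigma3; pose V := U * (sigma1 * sigma2 * sigma1).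
pose P := U * U; pose S := (U * sigma3 * P)^-1.
have U1 : U * sigma1 = sigma2 * U by exact: (braid_conj12 sac saba).
have U2 : U * sigma2 = sigma3 * U by exact: (braid_conj23 sac sbcb).
have UV : U ^+ 4 = V ^+ 2 by exact: (braid_quat_pow sac saba sbcb srel).
have VU : V * U * V^-1 = U^-1 by exact: (braid_quat_conj sac saba sbcb srel).
have SP : S * P = V * S by exact: (braid_rp sac saba sbcb srel).
have SV : S * V = P * V * S by exact: (braid_rq sac saba sbcb srel).
have S3 : S ^+ 3 = 1 by exact: (braid_r3 sac saba sbcb srel).
have PV : P ^+ 2 = V ^+ 2 by rewrite -UV /P !expgS !mulg1 !mulgA.
have VP : V * P * V^-1 = P^-1.
  exact: etrans (congr1 _ (quat_mulX VU 2)) (mulgK _ _).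
have [f1 [f1u f1v]] := quaternion_lift UV VU.
have [f2 [f2p f2q f2r]] := Tstar_lift PV VP SP SV S3.
have f12 h : f1 (i h) = f2 (j h).
  apply: (presented_ext (f := f1 \o i) (g := f2 \o j)) h; apply: I2_cases => /=.
    by rewrite iu jp multiplicativeX f1u f2p.
  by rewrite iv jq f1v f2q.
have [K [K1 K2]] := amalgam_lift f12.
have [Ku Kp Kr] : [/\ K u = U, K p = P & K r = S] by rewrite K1 !K2.
have Kv : K v = V by rewrite K1.
have FU : F U = u by rewrite !gmulfM F1 F2 F3.
have FKu : F (K u) = u by rewrite Ku.
have FP : F P = p by rewrite [LHS](gmulfM U U) FU.
have FKp : F (K p) = p by rewrite Kp.
have FKv : F (K v) = v.
  by rewrite Kv [LHS](gmulfM U _) FU !gmulfM F1 F2.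
have FKr : F (K r) = r.
  rewrite Kr multiplicativeV [F _](gmulfM (U * sigma3) P) (gmulfM U).
  by rewrite FU F3 FP.
exists F; exists K.
(* Each composite is compared with the identity on generators only. *)
- apply: (presented_ext (f := K \o F) (g := idfun)).
  have [x1 y2 z3] := amalgam_of_braid U1 U2 erefl (erefl S).
  apply: I3_cases;
    rewrite /= ?F1 ?F2 ?F3 !(multiplicativeV, gmulfM) /= Ku Kp Kr.
  + exact: x1.
  + exact: y2.
  + exact: z3.
- apply: (amalgam_ext (f := F \o K) (g := idfun)).
    apply: (presented_ext (f := F \o K \o amalgam_inl i j)
      (g := amalgam_inl i j)).
    by apply: I2_cases; [exact: FKu | exact: FKv].
  apply: (presented_ext (f := F \o K \o amalgam_inr i j)
    (g := amalgam_inr i j)).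
  apply: I3_cases; [exact: FKp | | exact: FKr].
  (* The generator q of [Tstar] is glued to v, where the composite is already known. *)
  exact: etrans (congr1 (F \o K) (esym vE)) (etrans FKv vE).
Qed.
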